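(* Let $X$ be a real Banach space with the Daugavet property and $Y\subset X$ a closed subspace. The following are equivalent: (i) $Y$ is wealthy in $X$. (ii) $Y$ is rich in $X$. (iii) Every finite-codimensional closed subspace of $Y$ is rich in $X$.
   Context: All Banach spaces are real and subspaces are closed; $S(X)$ is the unit sphere of $X$. An operator on $X$ is a bounded linear operator from $X$ into some Banach space. $X$ has the Daugavet property if $\|\mathrm{Id}+R\|=1+\|R\|$ for every rank-one operator $R\colon X\to X$. For operators $T_1\colon X\to Y_1$, $T_2\colon X\to Y_2$ define $T_1\mathbin{\tilde+}T_2\colon X\to Y_1\oplus_1Y_2$, $x\mapsto(T_1x,T_2x)$, so $\|(T_1\mathbin{\tilde+}T_2)x\|=\|T_1x\|+\|T_2x\|$. $T$ is a strong Daugavet operator if for all $x,y\in S(X)$ and $\varepsilon>0$ there is $z\in S(X)$ with $\|T(z-y)\|<\varepsilon$ and $\|z+x\|>2-\varepsilon$. $T$ is narrow if $T\mathbin{\tilde+}x^*$ is a strong Daugavet operator for every $x^*\in X^*$. A closed subspace $Y\subset X$ is rich in $X$ if the quotient map $q\colon X\to X/Y$ is narrow. $Y$ is wealthy in $X$ if $Y$ and every closed subspace of $X$ containing $Y$ have the Daugavet property. *)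

(* Defs.v *)
From HB Require Import structures.
From mathcomp Require Import all_boot all_order all_algebra ring_quotient.
From mathcomp Require Import all_classical all_reals all_analysis.

Set Implicit Arguments.
Unset Strict Implicit.
Unset Printing Implicit Defensive.

Import Order.TTheory GRing.Theory Num.Theory.
Import numFieldNormedType.Exports.

Local Open Scope classical_set_scope.
Local Open Scope ring_scope.

HB.mixin Record isBoundedOp (R : realType) (X Z : normedModType R)
    (T : X -> Z) := {
  bounded_op : bounded_fun_norm T
}.

#[short(type="boundedOp")]
HB.structure Definition BoundedOp (R : realType) (X Z : normedModType R) :=
  {T of @GRing.Linear R X Z *:%R T & isBoundedOp R X Z T}.

Section operator_norm.
Context {R : realType} {X Z : normedModType R}.

Definition unit_sphere : set X := [set x | `|x| = 1].

(* Meaningful for bounded linear maps only. It is stated for bare functions so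
   that it applies to [idfun \+ T] without further packaging. *)
Definition op_norm (T : X -> Z) : R :=
  sup [set `|T x| | x in [set x : X | `|x| <= 1]].

Definition rank_one (T : X -> Z) : Prop :=
  exists2 e : Z, e != 0 & range T = [set a *: e | a in [set: R]].

End operator_norm.
Arguments unit_sphere {R} X.

Definition daugavet {R : realType} (X : normedModType R) : Prop :=
  forall T : boundedOp X X, rank_one T -> op_norm (idfun \+ T) = 1 + op_norm T.

(* [V * W] itself carries the max norm, hence the alias. *)
Definition l1sum {R : realType} (V W : normedModType R) : Type := (V * W)%type.

Section l1sum_normed.
Context {R : realType} (V W : normedModType R).

HB.instance Definition _ :=
  GRing.Lmodule.copy (l1sum V W) (V * W)%type.

Definition l1norm (p : l1sum V W) : R := `|p.1| + `|p.2|.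

Lemma l1norm_triangle p q : l1norm (p + q) <= l1norm p + l1norm q.
Proof. by rewrite /l1norm addrACA lerD// ler_normD. Qed.

Lemma l1normZ (a : R) p : l1norm (a *: p) = `|a| * l1norm p.
Proof. by rewrite /l1norm mulrDr !normrZ. Qed.

Lemma l1norm0_eq0 p : l1norm p = 0 -> p = 0.
Proof.
case: p => x y /eqP; rewrite /l1norm /= paddr_eq0// !normr_eq0.
by move=> /andP[/eqP -> /eqP ->].
Qed.

HB.instance Definition _ := Lmodule_isNormed.Build R (l1sum V W)
  l1norm_triangle l1normZ l1norm0_eq0.

End l1sum_normed.

Section tilde_add.
Context {R : realType} {X Z1 Z2 : normedModType R}.
Variables (T1 : boundedOp X Z1) (T2 : boundedOp X Z2).

Definition tilde_add (x : X) : l1sum Z1 Z2 := (T1 x, T2 x).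

Lemma tilde_add_linear : linear tilde_add.
Proof. by move=> a x y; rewrite /tilde_add !linearP. Qed.

HB.instance Definition _ :=
  GRing.isLinear.Build R X (l1sum Z1 Z2) *:%R tilde_add tilde_add_linear.

Lemma tilde_add_bounded : bounded_fun_norm tilde_add.
Proof.
move=> r; have [M1 T1M1] := bounded_op (s := T1) r.
have [M2 T2M2] := bounded_op (s := T2) r.
exists (M1 + M2) => x xr.
by rewrite [leLHS]/(l1norm _)/l1norm lerD//= ?T1M1 ?T2M2.
Qed.

HB.instance Definition _ :=
  isBoundedOp.Build R X (l1sum Z1 Z2) tilde_add tilde_add_bounded.

Lemma tilde_add_normE x : `|tilde_add x| = `|T1 x| + `|T2 x|.
Proof. by []. Qed.

End tilde_add.

Section narrow.
Context {R : realType} {X Z : normedModType R}.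

Definition strong_daugavet_op (T : boundedOp X Z) : Prop :=
  forall x y : X, unit_sphere X x -> unit_sphere X y ->
  forall e : R, 0 < e ->
  exists z : X, [/\ unit_sphere X z, `|T (z - y)| < e & 2 - e < `|z + x|].

End narrow.

Definition narrow {R : realType} {X Z : normedModType R}
    (T : boundedOp X Z) : Prop :=
  forall f : boundedOp X R^o, strong_daugavet_op (tilde_add T f).

Record closedSubspace (R : realType) (X : normedModType R) := ClosedSubspace {
  subspace_set :> set X ;
  subspace0 : subspace_set 0 ;
  subspaceP : forall (a : R) (x y : X),
    subspace_set x -> subspace_set y -> subspace_set (a *: x + y) ;
  subspace_closed : closed subspace_set
}.

Section closed_subspace.
Context {R : realType} {X : normedModType R} (Y : closedSubspace X).

Definition subspace_pred : {pred X} := fun x => x \in (Y : set X).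

Lemma subspace_submod_closed : submod_closed subspace_pred.
Proof.
split; first by apply/mem_set; exact: subspace0.
by move=> a x y /set_mem Yx /set_mem Yy; apply/mem_set; exact: subspaceP.
Qed.

HB.instance Definition _ :=
  GRing.isSubmodClosed.Build R X subspace_pred subspace_submod_closed.

(* A record rather than [set_type Y], on which the library already puts the
   initial topology; here the topology is the one of the norm. *)
Record subspace_type : Type := SubspaceType {
  subspace_val :> X ;
  subspace_valP : subspace_val \in subspace_pred
}.

HB.instance Definition _ := [isSub for subspace_val].
HB.instance Definition _ := [Choice of subspace_type by <:].
HB.instance Definition _ := [SubChoice_isSubLmodule of subspace_type by <:].

Definition subspace_norm (x : subspace_type) : R := `|subspace_val x|.

Lemma subspace_normD x y :
  subspace_norm (x + y) <= subspace_norm x + subspace_norm y.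
Proof. exact: ler_normD. Qed.

Lemma subspace_normZ (a : R) x :
  subspace_norm (a *: x) = `|a| * subspace_norm x.
Proof. exact: normrZ. Qed.

Lemma subspace_norm0_eq0 x : subspace_norm x = 0 -> x = 0.
Proof. by move=> /normr0_eq0 x0; exact/val_inj. Qed.

HB.instance Definition _ := Lmodule_isNormed.Build R subspace_type
  subspace_normD subspace_normZ subspace_norm0_eq0.

Lemma subspace_normE (x : subspace_type) : `|x| = `|subspace_val x|.
Proof. by []. Qed.

End closed_subspace.

Section quotient_space.
Context {R : realType} {X : normedModType R} (Y : closedSubspace X).
Local Open Scope quotient_scope.

Definition quotient_space : Type := {ideal_quot (subspace_pred Y)}.

HB.instance Definition _ := GRing.Zmodule.on quotient_space.

Definition quotient_map (x : X) : quotient_space :=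
  \pi_({ideal_quot (subspace_pred Y)}) x.

Definition quotient_repr (u : quotient_space) : X := repr u.

Lemma quotient_reprK : cancel quotient_repr quotient_map.
Proof. exact: reprK. Qed.

Lemma quotient_map_eq x y :
  quotient_map x = quotient_map y <-> (Y : set X) (x - y).
Proof.
split=> [/eqP|Yxy].
  by rewrite -Quotient.idealrBE => /set_mem.
by apply/eqP; rewrite -Quotient.idealrBE; exact/mem_set.
Qed.

Lemma quotient_mapD x y :
  quotient_map (x + y) = quotient_map x + quotient_map y.
Proof. exact: raddfD. Qed.

Definition quotient_scale (a : R) (u : quotient_space) : quotient_space :=
  quotient_map (a *: quotient_repr u).

Lemma quotient_scaleE a x :
  quotient_scale a (quotient_map x) = quotient_map (a *: x).
Proof.
apply/quotient_map_eq; rewrite -scalerBr -[_ *: _]addr0.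
apply: subspaceP; last exact: subspace0.
by apply/quotient_map_eq; exact: quotient_reprK.
Qed.

Lemma quotient_scalerA a b u :
  quotient_scale a (quotient_scale b u) = quotient_scale (a * b) u.
Proof. by rewrite -(quotient_reprK u) !quotient_scaleE scalerA. Qed.

Lemma quotient_scale1r : left_id 1 quotient_scale.
Proof. by move=> u; rewrite -(quotient_reprK u) quotient_scaleE scale1r. Qed.

Lemma quotient_scalerDr : right_distributive quotient_scale +%R.
Proof.
move=> a u v; rewrite -(quotient_reprK u) -(quotient_reprK v).
by rewrite -quotient_mapD !quotient_scaleE -quotient_mapD scalerDr.
Qed.

Lemma quotient_scalerDl u : {morph quotient_scale^~ u : a b / a + b}.
Proof.
move=> a b; rewrite -(quotient_reprK u) !quotient_scaleE.
by rewrite -quotient_mapD scalerDl.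
Qed.

HB.instance Definition _ := GRing.Zmodule_isLmodule.Build R quotient_space
  quotient_scalerA quotient_scale1r quotient_scalerDr quotient_scalerDl.

Lemma quotient_map_linear : linear quotient_map.
Proof. by move=> a x y; rewrite quotient_mapD -quotient_scaleE. Qed.

HB.instance Definition _ := GRing.isLinear.Build R X quotient_space *:%R
  quotient_map quotient_map_linear.

Definition quotient_norm (u : quotient_space) : R :=
  inf [set `|x| | x in [set x : X | quotient_map x = u]].

Lemma quotient_norm_has_inf u :
  has_inf [set `|x| | x in [set x : X | quotient_map x = u]].
Proof.
split; last by exists 0 => _ [x _ <-].
by exists `|quotient_repr u|, (quotient_repr u) => //; exact: quotient_reprK.
Qed.

Lemma quotient_norm_le x : quotient_norm (quotient_map x) <= `|x|.
Proof. by apply: ge_inf; [case: (quotient_norm_has_inf (quotient_map x))|exists x]. Qed.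

Lemma quotient_norm_ge0 u : 0 <= quotient_norm u.
Proof.
by apply: lb_le_inf; [case: (quotient_norm_has_inf u)|move=> _ [x _ <-]].
Qed.

Lemma quotient_norm_lt u (e : R) : 0 < e ->
  exists2 x, quotient_map x = u & `|x| < quotient_norm u + e.
Proof.
move=> e0; have [_ [x xu <-] xe] := inf_adherent e0 (quotient_norm_has_inf u).
by exists x.
Qed.

Lemma quotient_normD u v :
  quotient_norm (u + v) <= quotient_norm u + quotient_norm v.
Proof.
apply/ler_addgt0Pr => e e0; have e20 : 0 < e / 2 by rewrite divr_gt0.
have [x <- xu] := quotient_norm_lt u e20.
have [y <- yv] := quotient_norm_lt v e20.
rewrite -quotient_mapD (le_trans (quotient_norm_le _))//.
rewrite (le_trans (ler_normD _ _))// [e]splitr addrACA.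
by rewrite ltW// ltrD.
Qed.

Lemma quotient_normZ_le (a : R) u :
  quotient_norm (a *: u) <= `|a| * quotient_norm u.
Proof.
apply/ler_addgt0Pr => e e0.
have a0 : 0 < `|a| + 1 by rewrite ltr_wpDl.
have [x <- xu] := quotient_norm_lt u (divr_gt0 e0 a0).
rewrite -linearZ (le_trans (quotient_norm_le _))// normrZ.
rewrite (le_trans (ler_wpM2l _ (ltW xu)))// mulrDr lerD2l.
by rewrite mulrCA ger_pMr// ler_pdivrMr// mul1r lerDl.
Qed.

Lemma quotient_normZ (a : R) u :
  quotient_norm (a *: u) = `|a| * quotient_norm u.
Proof.
apply/eqP; rewrite eq_le quotient_normZ_le /=.
have [->|a0] := eqVneq a 0; first by rewrite normr0 mul0r quotient_norm_ge0.
rewrite -ler_pdivlMl ?normr_gt0//.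
have := quotient_normZ_le a^-1 (a *: u).
by rewrite scalerA mulVf// scale1r normfV.
Qed.

Lemma quotient_norm0_eq0 u : quotient_norm u = 0 -> u = 0.
Proof.
move=> u0; rewrite -(quotient_reprK u) -(linear0 quotient_map).
apply/quotient_map_eq; rewrite subr0.
apply: (subspace_closed (c := Y)) => B /nbhs_ballP[e /= e0 eB].
have [x xu xe] := quotient_norm_lt u e0.
exists (quotient_repr u - x); split.
  by apply/quotient_map_eq; rewrite quotient_reprK xu.
apply: eB; rewrite -ball_normE /= opprB addrC subrK.
by rewrite u0 add0r in xe.
Qed.

HB.instance Definition _ := Lmodule_isNormed.Build R quotient_space
  quotient_normD quotient_normZ quotient_norm0_eq0.

Lemma quotient_map_bounded : bounded_fun_norm quotient_map.
Proof. by move=> r; exists r => x; exact/le_trans/quotient_norm_le. Qed.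

HB.instance Definition _ := isBoundedOp.Build R X quotient_space
  quotient_map quotient_map_bounded.

Lemma quotient_normE x :
  `|quotient_map x| = inf [set `|x - y| | y in (Y : set X)].
Proof.
rewrite [LHS]/(quotient_norm _)/quotient_norm; congr inf.
apply/seteqP; split=> _ [z zP <-].
  by exists (x - z); [exact/quotient_map_eq|rewrite subKr].
by exists (x - z) => //; apply/esym/quotient_map_eq; rewrite subKr.
Qed.

End quotient_space.

Section rich_wealthy.
Context {R : realType} {X : normedModType R}.

Definition rich (Y : closedSubspace X) : Prop := narrow (quotient_map Y).

Definition wealthy (Y : closedSubspace X) : Prop :=
  daugavet (subspace_type Y) /\
  forall Z : closedSubspace X, Y `<=` Z -> daugavet (subspace_type Z).

(* The images of [v 0], ..., [v (n - 1)] span [Y / Z]. *)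
Definition finite_codim_in (Y Z : closedSubspace X) : Prop :=
  exists (n : nat) (v : 'I_n -> X), (forall i, (Y : set X) (v i)) /\
    forall y, (Y : set X) y ->
    exists c : 'I_n -> R, (Z : set X) (y - \sum_(i < n) c i *: v i).

End rich_wealthy.

(* Main.v *)
From HB Require Import structures.
Require Import Defs.
From mathcomp Require Import all_boot all_order all_algebra.
From mathcomp Require Import all_classical all_reals all_analysis.
From mathcomp Require Import ring lra.

(** The three properties are proved in the cycle: wealthy, every
    finite-codimensional subspace of [Y] rich, [Y] rich, wealthy.

    Everything rests on the slice form of the Daugavet property
    ([daugavet_slicesP], [slices_daugavet]): for every unit vector [x], every
    slice of the unit ball contains points [z] with [`|x + z|] as close to 2 as
    desired. By [norm_scale_add_gt] such a [z] is almost l1-orthogonal to every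
    multiple of [x], so a slice contains points almost l1-orthogonal to any
    given vector.

    The analytic core is [daugavet_hilbertian]: in a space with the Daugavet
    property, points almost l1-orthogonal to [g] can be found not just in
    slices but arbitrarily close to any [u] of the ball, when closeness is
    measured by a bounded positive semidefinite form [b]. In other words,
    operators into a Hilbert space, in particular operators of finite rank, are
    narrow. Call [k] approachable if it is [b]-close to ball points almost
    l1-orthogonal to [g], for every [g]. Approachable points form a convex set:
    choose [z1] against [g] and then [z2] against [g] plus the multiple of [z1].
    Take the almost [b]-farthest point of the ball from a far away centre: it is
    dented, that is, it lies in [b]-small slices, hence it is approachable, and
    moving the centre to infinity shows that every half-space meeting the ball
    meets the approachable points ([l1_approx_slice]). A nearest-point argument
    for the semi-inner product [b] then shows that the approachable points are
    [b]-dense in the ball ([l1_approx_dense]). This plays the part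
    of the usual appeal to extreme points and convex combinations of slices.

    If [Y] is wealthy and [Z] has finite codimension in [Y], take unit vectors
    [x], [y] and a functional [f]. The closed span [E] of [Z], of finitely many
    vectors completing [Z] to [Y], and of [x] and [y] contains [Y], so it has
    the Daugavet property; and [Z] has finite codimension in [E], so that some
    bounded form on [E] controls the distance to [Z] ([finite_extension]).
    Adding the square of [f] to this form and applying [daugavet_hilbertian] in
    [E] yields the point asked for by narrowness of the quotient map
    ([wealthy_finite_codim_rich]).

    Conversely, let [Y] be rich and contained in [Z]. A functional on [Z] that
    defines a slice extends to the whole space by the Hahn-Banach theorem;
    richness moves a point of the slice almost within [Y], hence almost within
    [Z], to a point almost l1-orthogonal to a given [x], and a small correction
    brings it into [Z] ([rich_daugavet]). *)

Set Implicit Arguments.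
Unset Strict Implicit.
Unset Printing Implicit Defensive.

Import Order.TTheory GRing.Theory Num.Theory.
Import numFieldNormedType.Exports.

Local Open Scope classical_set_scope.
Local Open Scope ring_scope.

(** * The Hahn-Banach theorem *)
Section hahn_banach.
Context {R : realType} {V : lmodType R}.
Variable p : V -> R.
Hypothesis pD : forall x y, p (x + y) <= p x + p y.
Hypothesis pZ : forall (a : R) x, 0 <= a -> p (a *: x) = a * p x.

(** Partial functionals are represented by their graphs, so that the upper bound
    of a chain is a plain union. Domination by [p] makes such a graph
    single-valued ([dominated_graph_fun]). *)
Definition dominated_graph (G : set (V * R)) : Prop :=
  (forall (a : R) u v, G u -> G v -> G (a *: u.1 + v.1, a * u.2 + v.2)) /\
  (forall u, G u -> u.2 <= p u.1).

Lemma dominated_graph0 G u : dominated_graph G -> G u -> G (0, 0).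
Proof.
by move=> [GD _] Gu; have := GD (-1) _ _ Gu Gu; rewrite scaleN1r mulN1r !addNr.
Qed.

Lemma dominated_graphZ G (a : R) u : dominated_graph G -> G u ->
  G (a *: u.1, a * u.2).
Proof.
move=> Gdom Gu; have [GD _] := Gdom.
by have := GD a _ _ Gu (dominated_graph0 Gdom Gu); rewrite !addr0.
Qed.

(** The difference of two values at the same point is a value at 0, where [p]
    vanishes; the same holds for the opposite difference. *)
Lemma dominated_graph_fun G x r s : dominated_graph G ->
  G (x, r) -> G (x, s) -> r = s.
Proof.
move=> [GD Gp] Gr Gs; have p0 : p 0 = 0.
  by rewrite -(scale0r (0 : V)) pZ// mul0r.
have := Gp _ (GD (-1) _ _ Gr Gs); have := Gp _ (GD (-1) _ _ Gs Gr).
by rewrite /= scaleN1r !addNr p0; lra.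
Qed.

Definition graph_adjoin (G : set (V * R)) (x : V) (c : R) : set (V * R) :=
  [set w | exists2 u, G u & exists t : R, w = (u.1 + t *: x, u.2 + t * c)].

(** The one-dimensional step. Subadditivity of [p] makes every lower constraint
    [u.2 - p (u.1 - x)] on the value at [x] at most every upper constraint
    [p (v.1 + x) - v.2], and the supremum of the lower ones satisfies both
    kinds. *)
Lemma dominated_graph_adjoin G x : dominated_graph G -> G !=set0 ->
  exists c, dominated_graph (graph_adjoin G x c).
Proof.
move=> Gdom [u0 Gu0]; have [GD Gp] := Gdom.
have low_up u v : G u -> G v -> u.2 - p (u.1 - x) <= p (v.1 + x) - v.2.
  move=> Gu Gv; have := Gp _ (GD 1 _ _ Gu Gv).
  rewrite /= scale1r mul1r => h.
  have := pD (u.1 - x) (v.1 + x); rewrite addrACA addNr addr0.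
  lra.
pose S := [set u.2 - p (u.1 - x) | u in G].
have S0 : S !=set0 by exists (u0.2 - p (u0.1 - x)), u0.
have Sub : has_ubound S.
  by exists (p (u0.1 + x) - u0.2) => _ [u Gu <-]; exact: low_up.
have cl u : G u -> u.2 - p (u.1 - x) <= sup S.
  by move=> Gu; apply: ub_le_sup => //; exists u.
have cu u : G u -> sup S <= p (u.1 + x) - u.2.
  by move=> Gu; apply: ge_sup => // _ [v Gv <-]; exact: low_up.
exists (sup S); split.
  move=> a _ _ [u Gu [t ->]] [v Gv [s ->]].
  exists (a *: u.1 + v.1, a * u.2 + v.2); first exact: GD.
  exists (a * t + s); rewrite /=; congr pair; last by ring.
  by rewrite scalerDr scalerA addrACA -scalerDl.
move=> _ [u Gu [t ->]] /=.
have [t0|t0|->] := ltgtP t 0; last first.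
- by rewrite scale0r mul0r !addr0; exact: Gp.
- have := cu _ (dominated_graphZ t^-1 Gdom Gu) => /=.
  have -> : u.1 + t *: x = t *: (t^-1 *: u.1 + x).
    by rewrite scalerDr scalerA divff ?scale1r// gt_eqF.
  rewrite pZ ?(ltW t0)// => /(ler_wpM2l (ltW t0)).
  by rewrite mulrBr mulrA divff ?gt_eqF// mul1r => h; lra.
- have nt0 : 0 < - t by lra.
  have := cl _ (dominated_graphZ (- t)^-1 Gdom Gu) => /=.
  have -> : u.1 + t *: x = (- t) *: ((- t)^-1 *: u.1 - x).
    by rewrite scalerBr scalerA divff ?scale1r ?gt_eqF// scaleNr opprK.
  rewrite pZ ?(ltW nt0)// => /(ler_wpM2l (ltW nt0)).
  by rewrite mulrBr mulrA divff ?gt_eqF// mul1r => h; lra.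
Qed.

(** Zorn's lemma. The empty graph has to be admitted because it is the union of
    the empty chain; a maximal graph is not empty since [G0] is not. *)
Lemma dominated_graph_maximal G0 : dominated_graph G0 -> G0 !=set0 ->
  exists G, [/\ dominated_graph G, G0 `<=` G &
    forall H, dominated_graph H -> G `<=` H -> H `<=` G].
Proof.
move=> G0dom [u0 Gu0].
pose P (G : set (V * R)) := dominated_graph G /\ (G = set0 \/ G0 `<=` G).
have Pcup (F : set (set (V * R))) : F `<=` P -> total_on F subset ->
    P (\bigcup_(G in F) G).
  move=> FP Ftot; split; last first.
    have [[G [FG G0G]]|noG] := pselect (exists G, F G /\ G0 `<=` G).
      by right=> u /G0G Gu; exists G.
    left; apply/seteqP; split=> // u [G FG Gu].
    have [_ [G0' | G0G]] := FP _ FG; first by rewrite G0' in Gu.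
    by apply: noG; exists G.
  split=> [a u v [G FG Gu] [H FH Hv]|u [G FG Gu]].
    have [GH|HG] := Ftot _ _ FG FH.
      by exists H => //; apply: (FP _ FH).1.1 => //; exact: GH.
    by exists G => //; apply: (FP _ FG).1.1 => //; exact: HG.
  exact: (FP _ FG).1.2.
have [G [[Gdom G0G] Gmax]] := Zorn_bigcup Pcup.
have {}G0G : G0 `<=` G.
  case: G0G => // GE; exfalso; apply: (Gmax G0); last by split=> //; right.
  by rewrite GE; split=> // /(_ _ Gu0).
exists G; split=> // H Hdom GH.
apply: contrapT => HG; apply: (Gmax H); first by split.
by split=> //; right; exact: subset_trans GH.
Qed.

Lemma hahn_banach G0 : dominated_graph G0 -> G0 !=set0 ->
  exists g : V -> R, [/\ linear (g : V -> R^o),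
    forall u, G0 u -> g u.1 = u.2 & forall x, g x <= p x].
Proof.
move=> G0dom G00.
have [G [Gdom G0G Gmax]] := dominated_graph_maximal G0dom G00.
have [GD Gp] := Gdom.
have /choice[g Gg] : forall x, exists r, G (x, r).
  move=> x; have Gne : G !=set0 by case: G00 => u /G0G; exists u.
  have [c cdom] := dominated_graph_adjoin x Gdom Gne.
  have GH : G `<=` graph_adjoin G x c.
    move=> u Gu; exists u => //; exists 0.
    by rewrite scale0r mul0r !addr0; case: u Gu.
  have [u Gu] := Gne.
  exists c; apply: (Gmax _ cdom GH); exists (0, 0).
    exact: dominated_graph0 Gu.
  by exists 1; rewrite /= scale1r mul1r !add0r.
exists g; split=> [a x y|[x r] G0x|x].
- exact: dominated_graph_fun Gdom (Gg _) (GD a _ _ (Gg x) (Gg y)).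
- exact: dominated_graph_fun Gdom (Gg x) (G0G _ G0x).
- exact: Gp (Gg x).
Qed.

End hahn_banach.

(** * Bounded operators and functionals *)
Section bounded_operators.
Context {R : realType}.

Lemma boundedOpP {X Z : normedModType R} (T : boundedOp X Z) :
  exists2 M : R, 0 <= M & forall x, `|T x| <= M * `|x|.
Proof.
have [M TM] := bounded_op (s := T) 1.
have M0 : 0 <= M by have := TM 0; rewrite linear0 !normr0; apply.
exists M => // x; have [->|x0] := eqVneq x 0.
  by rewrite linear0 !normr0 mulr0.
have nx : 0 < `|x| by rewrite normr_gt0.
have := TM (`|x|^-1 *: x).
rewrite linearZ/= !normrZ normfV normr_id mulVf ?gt_eqF// lexx => /(_ isT).
by rewrite mulrC ler_pdivrMr.
Qed.

(** Packages a linear function with a bound, so that operators can be built from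
    formulas inside proofs. *)
Lemma boundedOp_intro {X Z : normedModType R} (f : X -> Z) (M : R) :
  linear f -> (forall x, `|f x| <= M * `|x|) ->
  exists T : boundedOp X Z, forall x, T x = f x.
Proof.
move=> flin fM.
have fbd : bounded_fun_norm f.
  move=> r; exists (`|M| * `|r|) => x xr; apply: (le_trans (fM x)).
  apply: (le_trans (ler_wpM2r (normr_ge0 x) (ler_norm M))).
  by apply: ler_wpM2l => //; apply: (le_trans xr); exact: ler_norm.
pose A := GRing.isLinear.Build R X Z *:%R f flin.
pose B := isBoundedOp.Build R X Z f fbd.
pose T : boundedOp X Z := HB.pack f A B.
by exists T.
Qed.

(** For a seminorm [p], domination of [f] by [p] at [x] and at [- x] bounds the
    absolute value. *)
Lemma dominated_boundedOp {X : normedModType R} (p : X -> R) (M : R)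
    (G : set (X * R)) :
  (forall x y, p (x + y) <= p x + p y) ->
  (forall a x, p (a *: x) = `|a| * p x) ->
  (forall x, p x <= M * `|x|) ->
  dominated_graph p G -> G !=set0 ->
  exists f : boundedOp X R^o, (forall u, G u -> f u.1 = u.2) /\
    forall x, `|f x| <= p x.
Proof.
move=> pD pZ pM Gdom G0.
have pZ' (a : R) x : 0 <= a -> p (a *: x) = a * p x.
  by move=> a0; rewrite pZ ger0_norm.
have [g [glin gG gp]] := hahn_banach pD pZ' Gdom G0.
have g_abs x : `|g x| <= p x.
  have gN : g (- x) = - g x.
    pose gl : {linear X -> R^o} :=
      HB.pack g (GRing.isLinear.Build R X R^o *:%R g glin).
    exact: (linearN gl).
  have pN : p (- x) = p x by rewrite -scaleN1r pZ normrN1 mul1r.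
  by rewrite ler_norml gp andbT lerNl -gN -pN gp.
have [x|T TE] := boundedOp_intro (M := M) glin.
  exact: le_trans (g_abs x) (pM x).
by exists T; split=> [u Gu|x]; rewrite TE; [exact: gG|exact: g_abs].
Qed.

Lemma boundedOp_extend {X : normedModType R} (Z : closedSubspace X)
    (f : boundedOp (subspace_type Z) R^o) :
  exists g : boundedOp X R^o,
    forall z : subspace_type Z, g (subspace_val z) = f z.
Proof.
have [M M0 fM] := boundedOpP f.
pose G := [set (subspace_val z, f z : R) | z in [set: subspace_type Z]].
have [||//|||g [gG _]] := @dominated_boundedOp X (fun x => M * `|x|) M G.
- by move=> x y; rewrite -mulrDr ler_wpM2l// ler_normD.
- by move=> a x; rewrite normrZ mulrCA.
- split=> [a _ _ [z _ <-] [w _ <-]|_ [z _ <-]].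
    by exists (a *: z + w) => //; congr pair; rewrite linearP.
  by apply: le_trans (ler_norm _) _; exact: fM.
- by exists (0, f 0), 0.
by exists g => z; apply: (gG (_, _)); exists z.
Qed.

(** The functional extends [t *: v |-> t] and is dominated by the seminorm
    [dist (x, Z) / dist (v, Z)], which vanishes on [Z]. *)
Lemma separating_functional {X : normedModType R} (Z : closedSubspace X)
    (v : X) : ~ (Z : set X) v ->
  exists f : boundedOp X R^o, (forall z, (Z : set X) z -> f z = 0) /\ f v = 1.
Proof.
move=> Zv.
have qv : 0 < `|quotient_map Z v|.
  rewrite normr_gt0; apply/eqP => qv0; apply: Zv.
  by rewrite -[v]subr0; apply/quotient_map_eq; rewrite qv0 linear0.
pose p x := `|quotient_map Z v|^-1 * `|quotient_map Z x|.
pose G := [set (t *: v, t) | t in [set: R]].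
have [|||||f [fG fp]] := @dominated_boundedOp X p (`|quotient_map Z v|^-1) G.
- move=> x y; rewrite /p -mulrDr ler_wpM2l ?invr_ge0//.
  by rewrite linearD ler_normD.
- by move=> a x; rewrite /p linearZ normrZ mulrCA.
- by move=> x; rewrite /p ler_wpM2l ?invr_ge0// quotient_norm_le.
- split=> [a _ _ [s _ <-] [t _ <-]|_ [t _ <-]] /=.
    by exists (a * s + t) => //; rewrite scalerDl scalerA.
  by rewrite /p linearZ normrZ mulrCA mulVf ?mulr1 ?ler_norm// gt_eqF.
- by exists (0 *: v, 0), 0.
exists f; split=> [z Zz|].
  apply/normr0_eq0/le_anti; rewrite normr_ge0 andbT (le_trans (fp z))//.
  rewrite /p (_ : quotient_map Z z = 0) ?normr0 ?mulr0//.
  by rewrite -(linear0 (quotient_map Z)); apply/quotient_map_eq; rewrite subr0.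
by rewrite -{1}[v]scale1r; apply: (fG (_, _)); exists 1.
Qed.

End bounded_operators.

(** * The slice form of the Daugavet property *)
Section slices.
Context {R : realType} {X : normedModType R}.

(** The slice is given by one of its points [u] and a depth [d], which avoids
    any reference to the norm of [f]. *)
Definition daugavet_slices : Prop :=
  forall (f : boundedOp X R^o) (x u : X) (d e : R),
  `|x| = 1 -> `|u| <= 1 -> 0 < d -> 0 < e ->
  exists z, [/\ `|z| <= 1, f u - d < f z & 2 - e < `|x + z|].

(** If [x] and [z] are almost l1-orthogonal, so are [s *: x] and [z]: the vector
    [(1 + s) *: (x + z)] is the sum of [s *: x + z] and of [x + s *: z], whose
    norm is at most [1 + s]. *)
Lemma norm_scale_add_gt (x z : X) (s e : R) : `|x| <= 1 -> `|z| <= 1 ->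
  0 <= s -> 2 - e < `|x + z| -> s + 1 - (1 + s) * e < `|s *: x + z|.
Proof.
move=> x1 z1 s0 xz.
have E : (1 + s) *: (x + z) = (s *: x + z) + (x + s *: z).
  by rewrite scalerDl scale1r scalerDr [LHS]addrACA [RHS]addrACA [x + _]addrC.
have h1 : (1 + s) * `|x + z| <= `|s *: x + z| + `|x + s *: z|.
  by rewrite -[X in X * _](@ger0_norm _ (1 + s)) ?addr_ge0// -normrZ E ler_normD.
have h2 : `|x + s *: z| <= 1 + s.
  rewrite (le_trans (ler_normD _ _))// normrZ (ger0_norm s0).
  by rewrite lerD// ler_piMr.
have := ltr_pM2l (_ : 0 < 1 + s) (2 - e) `|x + z|.
rewrite xz => /(_ ltac:(lra)) h3.
have : (1 + s) * (2 - e) < (1 + s) * `|x + z| by rewrite h3.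
lra.
Qed.

Lemma op_norm_has_sup (T : X -> X) (M : R) : (forall x, `|T x| <= M * `|x|) ->
  has_sup [set `|T x| | x in [set x : X | `|x| <= 1]].
Proof.
move=> TM; split; first by exists `|T 0|, 0 => //=; rewrite normr0.
exists `|M| => _ [x /= x1 <-]; apply: (le_trans (TM x)).
rewrite (le_trans (ler_norm _))// normrM normr_id.
by rewrite ler_piMr.
Qed.

Lemma op_norm_ge (T : X -> X) (M : R) x : (forall x, `|T x| <= M * `|x|) ->
  `|x| <= 1 -> `|T x| <= op_norm T.
Proof.
move=> TM x1; apply: ub_le_sup; last by exists x.
by case: (op_norm_has_sup TM).
Qed.

Lemma op_norm_adherent (T : X -> X) (M e : R) :
  (forall x, `|T x| <= M * `|x|) -> 0 < e ->
  exists2 x, `|x| <= 1 & op_norm T - e < `|T x|.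
Proof.
move=> TM e0; have [_ [x x1 <-] h] := sup_adherent e0 (op_norm_has_sup TM).
by exists x.
Qed.

Lemma add_id_bound (T : X -> X) (M : R) : (forall x, `|T x| <= M * `|x|) ->
  forall x, `|(idfun \+ T) x| <= (1 + M) * `|x|.
Proof.
by move=> TM x; rewrite (le_trans (ler_normD _ _))// mulrDl mul1r lerD2l.
Qed.

(** Apply the Daugavet equation to [T = f (.) *: x]. A point [v] that almost
    attains the norm of [id + T] almost attains that of [T], so it is deep in
    the slice; as [v] and [f v *: x] almost add up in norm, so do [v] and [x]. *)
Lemma daugavet_slicesP : daugavet X -> daugavet_slices.
Proof.
move=> dX f x u d e x1 u1 d0 e0.
have [M M0 fM] := boundedOpP f.
have xnz : x != 0 by rewrite -normr_gt0 x1.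
have [T TE] : exists T : boundedOp X X, forall v, T v = (f v : R) *: x.
  apply: (boundedOp_intro (M := M)) => [a v w|v].
    by rewrite linearP scalerDl scalerA.
  by rewrite normrZ x1 mulr1.
have Tf v : `|T v| = `|f v| by rewrite TE normrZ x1 mulr1.
have TM v : `|T v| <= M * `|v| by rewrite Tf.
pose N := op_norm T.
have fN v : `|v| <= 1 -> `|f v| <= N by move=> v1; rewrite -Tf (op_norm_ge TM).
have N0 : 0 <= N by apply: le_trans (fN 0 _); rewrite ?normr0.
have fuN : f u <= N by apply: le_trans (ler_norm _) (fN u u1).
have [N00|Nn0] := eqVneq N 0.
  exists x; split; first by rewrite x1.
    have := fN x; rewrite x1 lexx N00 normr_le0 => /(_ isT)/eqP ->.
    by rewrite N00 in fuN; lra.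
  by rewrite -mulr2n -[x *+ _]scaler_nat normrZ x1 ger0_norm//; lra.
have Np : 0 < N by rewrite lt_neqAle eq_sym Nn0.
have Tr1 : rank_one T.
  exists x => //; apply/seteqP; split => [_ [v _ <-]|_ [a _ <-]].
    by exists (f v) => //; rewrite TE.
  have [v fv] : exists v, f v != 0.
    apply: contrapT => fv0; move/eqP: Nn0; apply.
    apply/le_anti; rewrite N0 andbT.
    apply: ge_sup; first by case: (op_norm_has_sup TM).
    move=> _ [v v1 <-]; rewrite Tf normr_le0.
    by apply/negPn/negP => fv; apply: fv0; exists v.
  exists ((a / f v) *: v) => //.
  by rewrite TE linearZ /= /GRing.scale /= divfK.
(* The last bound gives [r <= e * (N - r)], which matters when [f v] is small. *)
pose r := Num.min d (Num.min e (e * N / (1 + e))).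
have e1 : 0 < 1 + e by lra.
have r0 : 0 < r by rewrite !lt_min d0 e0 divr_gt0// mulr_gt0.
have rd : r <= d by rewrite ge_min lexx.
have re : r <= e by rewrite !ge_min lexx !orbT.
have rN : r * (1 + e) <= e * N by rewrite -ler_pdivlMr// !ge_min lexx !orbT.
have [w w1] := op_norm_adherent (add_id_bound TM) r0.
rewrite (dX T Tr1) -/N => hw.
(* Both [w] and [- w] almost attain the norm of [id + T]; one of them lies in
   the slice. *)
have [v [v1 fv0 hv]] : exists v, [/\ `|v| <= 1, 0 <= f v &
    1 + N - r < `|v + T v|].
  have [fw|fw] := leP 0 (f w); first by exists w.
  exists (- w); split; first by rewrite normrN.
    by rewrite linearN oppr_ge0 ltW.
  by rewrite linearN -opprD normrN.
have fvN : f v <= N by apply: le_trans (ler_norm _) (fN v v1).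
have fvr : N - r < f v.
  by have := ler_normD v (T v); rewrite Tf (ger0_norm fv0); lra.
exists v; split => //; first lra.
set s : R := f v in fv0 fvN fvr.
have TvE : T v = s *: x by rewrite TE.
rewrite TvE in hv.
have [s1|s1] := leP 1 s.
  have : `|v + s *: x| <= `|x + v| + `|(s - 1) *: x|.
    apply: le_trans (ler_normD _ _).
    by rewrite scalerBl scale1r [x + v]addrC -addrA [x + _]addrC subrK.
  by rewrite normrZ x1 mulr1 ger0_norm ?subr_ge0//; lra.
have res : r < e * s.
  have : e * (N - r) < e * s by rewrite ltr_pM2l.
  lra.
have s0 : 0 < s by rewrite -(pmulr_rgt0 _ e0) (lt_trans r0).
have : `|v + s *: x| <= `|s *: (x + v)| + `|(1 - s) *: v|.
  apply: le_trans (ler_normD _ _).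
  by rewrite scalerDr scalerBl scale1r -addrA [s *: v + _]addrC subrK addrC.
rewrite !normrZ (gtr0_norm s0) (@ger0_norm _ (1 - s)) ?subr_ge0 ?(ltW s1)// => h1.
have h2 : (1 - s) * `|v| <= 1 - s by rewrite ler_piMr// subr_ge0 ltW.
have : s * (2 - e) < s * `|x + v| by lra.
by rewrite ltr_pM2l.
Qed.

(** Write [T = f (.) *: x] with [x] a unit vector and [N] the norm of [f]. A
    point [z] of a thin slice of [f] is mapped by [T] close to [N *: x], and it
    is almost l1-orthogonal to [x], hence to [N *: x]. *)
Lemma slices_daugavet : daugavet_slices -> daugavet X.
Proof.
move=> sX T [e0 e0nz Trange].
have ne0 : 0 < `|e0| by rewrite normr_gt0.
pose x := `|e0|^-1 *: e0.
have x1 : `|x| = 1 by rewrite normrZ normfV normr_id mulVf// gt_eqF.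
have xnz : x != 0 by rewrite -normr_gt0 x1.
have [M M0 TM] := boundedOpP T.
have /choice[f fE] : forall v, exists r : R, T v = r *: x.
  move=> v; have : range T (T v) by exists v.
  rewrite Trange => -[a _ <-]; exists (a * `|e0|).
  by rewrite scalerA -mulrA divff ?mulr1// gt_eqF.
have Tf v : `|T v| = `|f v| by rewrite fE normrZ x1 mulr1.
have xI a b : a *: x = b *: x -> a = b.
  move/eqP; rewrite -subr_eq0 -scalerBl scaler_eq0 (negbTE xnz) orbF subr_eq0.
  by move/eqP.
have flin : linear (f : X -> R^o).
  move=> a v w; apply: xI.
  by rewrite -fE linearP /= !fE scalerA -scalerDl.
have [F FE] : exists F : boundedOp X R^o, forall v, F v = f v.
  by apply: (boundedOp_intro (M := M) flin) => v; rewrite -[leLHS]Tf.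
pose N := op_norm T.
have TN v : `|v| <= 1 -> `|T v| <= N by exact: op_norm_ge.
have N0 : 0 <= N by apply: le_trans (TN 0 _); rewrite ?normr0.
apply/le_anti/andP; split.
  apply: ge_sup; first by case: (op_norm_has_sup (add_id_bound TM)).
  move=> _ [v /= v1 <-]; rewrite (le_trans (ler_normD _ _))//.
  by rewrite lerD// TN.
apply/ler_addgt0Pr => r r0.
pose d := r / (3 + N).
have d0 : 0 < d by rewrite divr_gt0//; lra.
have dr : (3 + N) * d = r by rewrite /d mulrC divfK// gt_eqF//; lra.
have [w w1] := op_norm_adherent TM d0; rewrite -/N Tf => hw.
have [u [u1 fu]] : exists u, `|u| <= 1 /\ N - d < F u.
  have [fw|fw] := leP 0 (f w).
    by exists w; rewrite FE; move: hw; rewrite ger0_norm.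
  exists (- w); rewrite normrN linearN /= FE; split => //.
  by move: hw; rewrite ltr0_norm.
have [z [z1 fz xz]] := sX F x u d d x1 u1 d0 d0.
have zx := norm_scale_add_gt (eq_ind_r (fun r => r <= 1) (lexx 1) x1) z1 N0 xz.
have := op_norm_ge (add_id_bound TM) z1.
have : `|N *: x + z| <= `|(idfun \+ T) z| + `|(N - f z) *: x|.
  apply: le_trans (ler_normD _ _); rewrite /= fE.
  by rewrite scalerBl -addrA [f z *: x + _]addrC subrK addrC.
have fzN : f z <= N by apply: le_trans (TN z z1); rewrite Tf ler_norm.
rewrite normrZ x1 mulr1 ger0_norm ?subr_ge0//.
rewrite !FE in fu fz => h1 h2.
lra.
Qed.

End slices.
Arguments daugavet_slices {R} X.

(** * Bounded positive semidefinite forms *)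
Record bounded_psd {R : realType} {X : normedModType R} (b : X -> X -> R) :
    Prop := BoundedPsd {
  psd_linear : forall v (a : R) x y, b (a *: x + y) v = a * b x v + b y v ;
  psd_sym : forall x y, b x y = b y x ;
  psd_ge0 : forall x, 0 <= b x x ;
  psd_bounded : exists2 M : R, 0 <= M & forall x y, `|b x y| <= M * `|x| * `|y|
}.

Section psd_theory.
Context {R : realType} {X : normedModType R} (b : X -> X -> R).
Hypothesis bpsd : bounded_psd b.

Lemma psdDl x y v : b (x + y) v = b x v + b y v.
Proof. by have := psd_linear bpsd v 1 x y; rewrite scale1r mul1r. Qed.

Lemma psd0l v : b 0 v = 0.
Proof. by apply: (addrI (b 0 v)); rewrite -psdDl !addr0. Qed.

Lemma psdZl a x v : b (a *: x) v = a * b x v.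
Proof. by have := psd_linear bpsd v a x 0; rewrite psd0l !addr0. Qed.

Lemma psdNl x v : b (- x) v = - b x v.
Proof. by rewrite -scaleN1r psdZl mulN1r. Qed.

Lemma psdDr x y v : b v (x + y) = b v x + b v y.
Proof. by rewrite !(psd_sym bpsd v) psdDl. Qed.

Lemma psdZr a x v : b v (a *: x) = a * b v x.
Proof. by rewrite !(psd_sym bpsd v) psdZl. Qed.

Lemma psdNr x v : b v (- x) = - b v x.
Proof. by rewrite !(psd_sym bpsd v) psdNl. Qed.

Lemma psdBr x y v : b v (x - y) = b v x - b v y.
Proof. by rewrite psdDr psdNr. Qed.

Definition psdE := (psdDl, psdDr, psdNl, psdNr, psdZl, psdZr).

Lemma psdB x y : b (x - y) (x - y) = b x x - 2 * b x y + b y y.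
Proof. by rewrite !psdE (psd_sym bpsd y x); ring. Qed.

Lemma psd_functional v : exists f : boundedOp X R^o, forall x, f x = b v x.
Proof.
have [M M0 bM] := psd_bounded bpsd.
apply: (boundedOp_intro (M := M * `|v|)) => // a x y.
by rewrite psdDr psdZr.
Qed.

Lemma psd_ball_bound : exists M : R, [/\ 0 <= M,
    forall x y, `|x| <= 1 -> `|y| <= 1 -> `|b x y| <= M &
    forall x y, `|x| <= 1 -> `|y| <= 1 -> b (x - y) (x - y) <= 4 * M].
Proof.
have [M M0 bM] := psd_bounded bpsd.
have bM1 x y : `|x| <= 1 -> `|y| <= 1 -> `|b x y| <= M.
  move=> x1 y1; apply: (le_trans (bM x y)).
  by rewrite (le_trans (ler_piMr _ y1))// ?mulr_ge0// ler_piMr.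
exists M; split=> // x y x1 y1.
have := bM1 _ _ x1 x1; have := bM1 _ _ y1 y1; have := bM1 _ _ x1 y1.
rewrite psdB; have := ler_norm (b x x); have := ler_norm (b y y).
by have := ler_norm (- b x y); rewrite normrN; lra.
Qed.

End psd_theory.

(** * Approximation in the semi-inner product of a form *)
Section hilbertian.
Context {R : realType} {X : normedModType R} (b : X -> X -> R).
Hypothesis bpsd : bounded_psd b.
Hypothesis sX : daugavet_slices X.
Variable x0 : X.
Hypothesis x01 : `|x0| = 1.

(** The unit vector [x0] is used when [g] is 0, to obtain points whose norm is
    almost 1. *)
Lemma slice_almost_l1 (f : boundedOp X R^o) (g u : X) (d e : R) :
  `|u| <= 1 -> 0 < d -> 0 < e ->
  exists z, [/\ `|z| <= 1, f u - d < f z & `|g| + 1 - e < `|g + z|].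
Proof.
move=> u1 d0 e0.
have [x [x1 gx]] : exists x : X, `|x| = 1 /\ g = `|g| *: x.
  have [->|g0] := eqVneq g 0; first by exists x0; rewrite normr0 scale0r.
  have ng : `|g| != 0 by rewrite normr_eq0.
  exists (`|g|^-1 *: g); rewrite normrZ normfV normr_id mulVf//.
  by rewrite scalerA divff// scale1r.
have g0 : 0 < 1 + `|g| by have := normr_ge0 g; lra.
have [z [z1 fz xz]] := sX f x1 u1 d0 (divr_gt0 e0 g0).
exists z; split=> //; rewrite [in ltRHS]gx.
have x1' : `|x| <= 1 by rewrite x1.
have := norm_scale_add_gt x1' z1 (normr_ge0 g) xz.
by rewrite mulrC divfK// gt_eqF.
Qed.

(** The points [k] that lie within [b]-distance [h] (squared) of ball points
    almost l1-orthogonal to any prescribed vector. Quantifying over all [g] is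
    what makes this set convex. *)
Definition l1_approx (h : R) (k : X) : Prop :=
  forall (g : X) (e : R), 0 < e ->
  exists z, [/\ `|z| <= 1, b (z - k) (z - k) < h & `|g| + 1 - e < `|g + z|].

(** The first point is chosen almost l1-orthogonal to [g], the second one to [g]
    plus the contribution of the first, so that the norms keep adding up. *)
Lemma l1_approx_convex h k1 k2 t : 0 < t -> t < 1 ->
  l1_approx h k1 -> l1_approx h k2 ->
  l1_approx h ((1 - t) *: k1 + t *: k2).
Proof.
move=> t0 t1 W1 W2 g e e0; have s0 : 0 < 1 - t by lra.
have [z1 [z11 bz1 gz1]] := W1 ((1 - t)^-1 *: g) e e0.
have [z2 [z21 bz2 gz2]] := W2 (t^-1 *: (g + (1 - t) *: z1)) e e0.
exists ((1 - t) *: z1 + t *: z2); split.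
- rewrite (le_trans (ler_normD _ _))// !normrZ (gtr0_norm t0) (gtr0_norm s0).
  have := ler_wpM2l (ltW t0) z21; have := ler_wpM2l (ltW s0) z11; lra.
- have -> : (1 - t) *: z1 + t *: z2 - ((1 - t) *: k1 + t *: k2) =
      (1 - t) *: (z1 - k1) + t *: (z2 - k2).
    by rewrite !scalerBr opprD addrACA.
  move: (z1 - k1) (z2 - k2) bz1 bz2 => a c ba bc.
  have := psd_ge0 bpsd (a - c); rewrite (psdB bpsd) => ac.
  rewrite !(psdE bpsd) (psd_sym bpsd c a).
  have := mulr_ge0 (ltW (mulr_gt0 t0 s0)) ac.
  have := ltr_pM2l s0 (b a a) h; rewrite ba => /esym/idP.
  have := ltr_pM2l t0 (b c c) h; rewrite bc => /esym/idP.
  nra.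
- have h1 : `|g| + (1 - t) - (1 - t) * e < `|g + (1 - t) *: z1|.
    have -> : g + (1 - t) *: z1 = (1 - t) *: ((1 - t)^-1 *: g + z1).
      by rewrite scalerDr scalerA divff ?scale1r// gt_eqF.
    move: gz1; rewrite !normrZ normfV (gtr0_norm s0) -(ltr_pM2l s0).
    by rewrite mulrBr mulrDr mulrA divff ?gt_eqF// mul1r mulr1.
  move: h1 gz2; set g' := g + _ => h1.
  rewrite addrA -/g'.
  have -> : g' + t *: z2 = t *: (t^-1 *: g' + z2).
    by rewrite scalerDr scalerA divff ?scale1r// gt_eqF.
  rewrite !normrZ normfV (gtr0_norm t0) -(ltr_pM2l t0).
  rewrite mulrBr mulrDr mulrA divff ?gt_eqF// mul1r mulr1.
  by move=> h2; lra.
Qed.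

(** Every half-space [c < b p] that meets the ball contains an approachable
    point of the ball. Let [v] be almost [b]-farthest from [far = u - N *: p]
    among the points of the ball. A ball point in a thin slice of
    [b (v - far)] containing [v] cannot be [b]-far from [v], or it would be
    farther than [v] from [far]; so [v] is approachable, by points of this
    slice. Comparing the distances from [far] to [v] and to [u] gives
    [b p v >= b p u] up to an error of order [1 / N]. *)
Lemma l1_approx_slice h p u c : 0 < h -> `|u| <= 1 -> c < b p u ->
  exists k, [/\ `|k| <= 1, l1_approx h k & c < b p k].
Proof.
move=> h0 u1 cu; have [M [M0 bM b4M]] := psd_ball_bound bpsd.
pose d := h / 4; have d0 : 0 < d by rewrite divr_gt0.
pose gam := b p u - c; have gam0 : 0 < gam by rewrite subr_gt0.
(* Large enough for the error [(d + 4 * M) / (2 * N)] below to be at most the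
   margin [gam]. *)
pose N := (d + 4 * M) / (2 * gam).
have N0 : 0 < N by rewrite divr_gt0//; lra.
have NE : 2 * N * gam = d + 4 * M.
  by rewrite /N; field; rewrite gt_eqF.
have [far farE] : exists w, w = u - N *: p by exists (u - N *: p).
pose S := [set b (v - far) (v - far) | v in [set v : X | `|v| <= 1]].
have Ssup : has_sup S.
  split; first by exists (b (u - far) (u - far)), u.
  have [M' M'0 bM'] := psd_bounded bpsd.
  exists (M + 2 * (M' * 1 * `|far|) + b far far) => _ [v /= v1 <-].
  rewrite (psdB bpsd); have := ler_norm (b v v); have := bM _ _ v1 v1.
  have := bM' v far; have := ler_norm (- b v far); rewrite normrN.
  have : M' * `|v| * `|far| <= M' * 1 * `|far|.
    by rewrite ler_wpM2r// ler_wpM2l.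
  lra.
have [_ [v v1 <-] vsup] := sup_adherent d0 Ssup.
have vmax w : `|w| <= 1 -> b (w - far) (w - far) < b (v - far) (v - far) + d.
  move=> w1; rewrite -ltrBlDr (le_lt_trans _ vsup)// lerD2r.
  by apply: ub_le_sup; [case: Ssup|exists w].
exists v; split=> //.
  move=> g e e0; have [f fE] := psd_functional bpsd (v - far).
  have [z [z1 fz gz]] := slice_almost_l1 f g v1 d0 e0.
  exists z; split=> //.
  have zv : z - v = (z - far) - (v - far) by rewrite opprB addrA subrK.
  rewrite zv (psdB bpsd) (psd_sym bpsd (z - far)).
  have := vmax z z1; rewrite !fE in fz.
  have -> : b (v - far) (z - far) = b (v - far) z - b (v - far) far by rewrite -(psdBr bpsd).
  have : b (v - far) (v - far) = b (v - far) v - b (v - far) far.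
    by rewrite -(psdBr bpsd).
  rewrite /d; set A := b (v - far) (v - far); rewrite /d in fz.
  lra.
have ufar : u - far = N *: p by rewrite farE opprB addrC subrK.
have vfar : v - far = N *: p - (u - v).
  by rewrite farE !opprB addrCA.
have := vmax u u1; rewrite ufar vfar (psdB bpsd) => h1.
have h2 := b4M _ _ u1 v1.
have h3 : b (N *: p) (u - v) = N * (b p u - b p v) by rewrite (psdZl bpsd) (psdBr bpsd).
rewrite h3 in h1.
have : 2 * N * (b p u - b p v) < 2 * N * gam by lra.
have N20 : 0 < 2 * N by lra.
by rewrite (ltr_pM2l N20) /gam => h4; lra.
Qed.

(** Let [k0] be an approachable point of the ball almost [b]-nearest to [u], at
    squared distance [A]. If [A] stayed away from 0, then [l1_approx_slice] for
    the direction [u - k0] would give an approachable [k] beyond the middle of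
    the way from [k0] to [u], and moving from [k0] towards [k] would bring the
    approachable point [b]-closer to [u] by a definite amount. *)
Lemma l1_approx_dense h u d : 0 < h -> 0 < d -> `|u| <= 1 ->
  exists2 k, l1_approx h k & b (u - k) (u - k) < d.
Proof.
move=> h0 d0 u1; have [M [M0 _ b4M]] := psd_ball_bound bpsd.
pose K := [set k : X | `|k| <= 1 /\ l1_approx h k].
pose S := [set b (u - k) (u - k) | k in K].
have Sinf : has_inf S.
  split; last by exists 0 => _ [k _ <-]; exact: psd_ge0.
  have [|k [k1 Wk _]] := @l1_approx_slice h 0 u (-1) h0 u1.
    by rewrite (psd0l bpsd); lra.
  by exists (b (u - k) (u - k)), k.
have infle k : K k -> inf S <= b (u - k) (u - k).
  by move=> Kk; apply: ge_inf; [case: Sinf|exists k].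
have [I0|I0] := leP (inf S) 0.
  have [_ [k [_ Wk] <-] kd] := inf_adherent d0 Sinf.
  by exists k => //; lra.
exfalso; set I := inf S in infle I0.
pose L := 4 * M + 1; have L0 : 0 < L by rewrite /L; lra.
have dl0 : 0 < I ^+ 2 / (4 * L) by rewrite divr_gt0// ?exprn_gt0// mulr_gt0.
have [_ [k0 [k01 Wk0] <-] hk0] := inf_adherent dl0 Sinf.
have IA := infle k0 (conj k01 Wk0).
rewrite -/I in hk0.
pose A := b (u - k0) (u - k0); rewrite -/A in hk0 IA.
have AL : A < L by have := b4M _ _ u1 k01; rewrite -/A /L; lra.
have [|k [k1 Wk hk]] := @l1_approx_slice h (u - k0) u (b (u - k0) u - A / 2) h0 u1.
  by lra.
(* This [t] minimizes [A - t * A + t ^+ 2 * L], a bound for the squared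
   distance from [u] to [(1 - t) *: k0 + t *: k]. *)
pose t := A / (2 * L).
have t0 : 0 < t by rewrite divr_gt0//; lra.
have t1 : t < 1 by rewrite ltr_pdivrMr; lra.
have tL : 2 * (t * L) = A by rewrite /t; field; rewrite gt_eqF.
have tE : t = A / (2 * L) by [].
clearbody t.
pose kt := (1 - t) *: k0 + t *: k.
have Kt : K kt.
  split; last exact: l1_approx_convex.
  rewrite /kt (le_trans (ler_normD _ _))// !normrZ (gtr0_norm t0) gtr0_norm; last lra.
  have := ler_wpM2l (ltW t0) k1; have := ler_wpM2l (_ : 0 <= 1 - t) k01; lra.
have uk : u - kt = (u - k0) - t *: (k - k0).
  by rewrite /kt scalerBl scale1r scalerBr !opprD !opprK -!addrA [_ - t *: k]addrC.
have := infle kt Kt; rewrite uk (psdB bpsd) (psdZr bpsd) !(psdZl bpsd) (psdZr bpsd).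
rewrite -/A.
have hkk : A / 2 < b (u - k0) (k - k0).
  rewrite (psdBr bpsd); move: hk.
  have : A = b (u - k0) u - b (u - k0) k0 by rewrite -(psdBr bpsd).
  lra.
have := b4M _ _ k1 k01; set B := b (k - k0) (k - k0) => BL.
set C := b (u - k0) (k - k0) in hkk *.
move=> hfin.
have s1 : t * (A / 2) < t * C by rewrite ltr_pM2l.
have s2 : t * (t * B) <= t * (t * L).
  by rewrite !ler_pM2l// /L; lra.
have s3 : I <= A - t * A + t * (t * L) by lra.
have s4 : t * (t * L) = t * A / 2 by rewrite -tL; field.
have s5 : t * A = 2 * (A ^+ 2 / (4 * L)).
  by rewrite tE; field; rewrite gt_eqF.
have s6 : I ^+ 2 / (4 * L) <= A ^+ 2 / (4 * L).
  by rewrite ler_pM2r ?invr_gt0 ?mulr_gt0// lerXn2r// ?nnegrE//; lra.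
lra.
Qed.

Lemma daugavet_hilbertian u g h e : `|u| <= 1 -> 0 < h -> 0 < e ->
  exists z, [/\ `|z| <= 1, b (z - u) (z - u) < h & `|g| + 1 - e < `|g + z|].
Proof.
move=> u1 h0 e0; have h40 : 0 < h / 4 by rewrite divr_gt0.
have [k Wk ku] := l1_approx_dense h40 h40 u1.
have [z [z1 zk gz]] := Wk g e e0; exists z; split=> //.
have -> : z - u = (z - k) - (u - k) by rewrite opprB addrA subrK.
have := psd_ge0 bpsd ((z - k) + (u - k)).
rewrite (psdB bpsd) !(psdDl bpsd (z - k)) !(psdDr bpsd (z - k)).
rewrite (psd_sym bpsd (u - k) (z - k)).
lra.
Qed.

End hilbertian.

(** * Finite-dimensional extensions of a closed subspace *)
Section finite_extensions.
Context {R : realType} {X : normedModType R}.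

Lemma boundedOp_continuous {W : normedModType R} (T : boundedOp X W) :
  continuous T.
Proof. exact/bounded_linear_continuous/bounded_funP/bounded_op. Qed.

Lemma bounded_psd0 : bounded_psd (fun _ _ : X => 0 : R).
Proof.
split=> //; first by move=> *; rewrite mulr0 addr0.
by exists 0 => // x y; rewrite normr0 !mul0r.
Qed.

(** Such forms arise by adding one coordinate [f] to a form in fewer
    coordinates; [T] is the projection along the new direction, or an
    inclusion. *)
Lemma bounded_psd_rank1D {W : normedModType R} (b : W -> W -> R)
    (T : boundedOp X W) (f : boundedOp X R^o) : bounded_psd b ->
  bounded_psd (fun x y => b (T x) (T y) + f x * f y).
Proof.
move=> bpsd; split.
- move=> v a x y; rewrite !linearP /= (psdDl bpsd) (psdZl bpsd).
  by rewrite /GRing.scale /=; ring.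
- by move=> x y; rewrite (psd_sym bpsd) [f x * _]mulrC.
- by move=> x; rewrite addr_ge0 ?(psd_ge0 bpsd)// -expr2 sqr_ge0.
have [B B0 bB] := psd_bounded bpsd.
have [M M0 TM] := boundedOpP T; have [N N0 fN] := boundedOpP f.
exists (B * M * M + N * N) => [|x y]; first by rewrite addr_ge0// !mulr_ge0.
rewrite (le_trans (ler_normD _ _))// !mulrDl lerD//.
  apply: (le_trans (bB _ _)).
  have := ler_pM (normr_ge0 _) (normr_ge0 _) (TM x) (TM y).
  move=> /(ler_wpM2l B0); rewrite mulrA => /le_trans; apply.
  by rewrite le_eqVlt; apply/orP; left; apply/eqP; ring.
rewrite normrM; have := ler_pM (normr_ge0 _) (normr_ge0 _) (fN x) (fN y).
by rewrite mulrACA mulrA.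
Qed.

Lemma oblique_projection (v : X) (f : boundedOp X R^o) :
  exists P : boundedOp X X, forall w, P w = w - (f w : R) *: v.
Proof.
have [N N0 fN] := boundedOpP f.
apply: (boundedOp_intro (M := 1 + N * `|v|)).
  move=> a x y; rewrite linearP /= scalerDl opprD addrACA scalerBr scalerA.
  by [].
move=> w; rewrite (le_trans (ler_normD _ _))// mulrDl mul1r lerD2l normrN normrZ.
by rewrite mulrAC ler_wpM2r.
Qed.

(** The form is a sum of squares of coordinates on [E] modulo [Z]. When [v] is
    adjoined to [E], a functional [f] vanishing on [E] with [f v = 1] provides
    the new coordinate, and the enlarged space is the preimage of [E] under the
    projection [w |-> w - f w *: v], which makes it closed. *)
Lemma finite_extension (Z : closedSubspace X) (vs : seq X) :
  exists (E : closedSubspace X) (b : X -> X -> R),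
  [/\ Z `<=` E, forall v, v \in vs -> (E : set X) v, bounded_psd b &
  forall e : R, 0 < e -> exists2 d : R, 0 < d & forall w, (E : set X) w ->
    b w w < d -> exists2 z, (Z : set X) z & `|w - z| < e].
Proof.
elim: vs => [|v vs [E [b [ZE vsE bpsd bZ]]]].
  exists Z, (fun _ _ => 0); split=> //; first exact: bounded_psd0.
  by move=> e e0; exists 1 => // w Zw _; exists w => //; rewrite subrr normr0.
have [Ev|nEv] := pselect ((E : set X) v).
  exists E, b; split=> // w; rewrite inE => /orP[/eqP ->//|]; exact: vsE.
have [f [fE fv]] := separating_functional nEv.
have [P PE] := oblique_projection v f.
have E'0 : (E : set X) (P 0) by rewrite linear0; exact: subspace0.
have E'D (a : R) x y : (E : set X) (P x) -> (E : set X) (P y) ->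
    (E : set X) (P (a *: x + y)).
  by rewrite linearP; exact: subspaceP.
have E'cl : closed (P @^-1` E).
  apply: preimage_closed; last exact: subspace_closed.
  by move=> x _; exact: boundedOp_continuous.
pose E' : closedSubspace X := ClosedSubspace E'0 E'D E'cl.
have EE' : E `<=` E' by move=> w Ew; rewrite /= PE fE// scale0r subr0.
exists E', (fun x y => b (P x) (P y) + f x * f y); split.
- exact: subset_trans ZE EE'.
- move=> w; rewrite inE => /orP[/eqP ->|/vsE/EE'//].
  by rewrite /= PE fv scale1r subrr; exact: subspace0.
- exact: bounded_psd_rank1D.
move=> e e0; have e20 : 0 < e / 2 by rewrite divr_gt0.
have [d d0 dZ] := bZ _ e20.
have v0 : 0 < 2 * (`|v| + 1) by rewrite mulr_gt0// ltr_wpDl.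
pose r := e / (2 * (`|v| + 1)); have r0 : 0 < r by rewrite divr_gt0.
exists (Num.min d (r ^+ 2)) => [|w E'w]; first by rewrite lt_min d0 exprn_gt0.
rewrite lt_min => /andP[wd wr].
have fw2 : 0 <= f w * f w by rewrite -expr2 sqr_ge0.
have [|z Zz Pwz] := dZ _ E'w; first by lra.
exists z => //.
have fwr : `|f w| < r.
  have := psd_ge0 bpsd (P w) => bPw.
  rewrite -(ltr_pXn2r (n := 2))// ?nnegrE ?(ltW r0)//.
  by rewrite -normrX ger0_norm ?sqr_ge0// expr2; lra.
have -> : w - z = (P w - z) + (f w : R) *: v by rewrite PE addrAC subrK.
rewrite (le_lt_trans (ler_normD _ _))// normrZ [ltRHS]splitr ltr_leD//.
have : `|f w| * `|v| <= r * (`|v| + 1) by rewrite ler_pM// ?ltW// ltrDl.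
have -> : r * (`|v| + 1) = e / 2 by rewrite /r; field; rewrite gt_eqF.
by [].
Qed.

End finite_extensions.

(** * Rich and wealthy subspaces *)
Section rich_subspaces.
Context {R : realType} {X : normedModType R}.

Lemma quotient_norm_dist_le (Z : closedSubspace X) w z : (Z : set X) z ->
  `|quotient_map Z w| <= `|w - z|.
Proof.
move=> Zz; rewrite (_ : quotient_map Z w = quotient_map Z (w - z)).
  exact: quotient_norm_le.
by apply/quotient_map_eq; rewrite subKr.
Qed.

Lemma unit_sphere_close (z : X) (r : R) : r < 1 -> 1 - r < `|z| ->
  `|z| <= 1 -> exists2 w, `|w| = 1 & `|w - z| < r.
Proof.
move=> r1 rz z1; have z0 : 0 < `|z| by lra.
exists (`|z|^-1 *: z); first by rewrite normrZ normfV normr_id mulVf// gt_eqF.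
rewrite -[X in _ - X]scale1r -scalerBl normrZ ger0_norm; last first.
  by rewrite subr_ge0 invr_ge1 ?unitfE ?gt_eqF.
rewrite mulrBl mulVf ?gt_eqF//; lra.
Qed.

Lemma subspace_val_boundedOp (E : closedSubspace X) :
  exists T : boundedOp (subspace_type E) X, forall x, T x = subspace_val x.
Proof.
by apply: (boundedOp_intro (M := 1)) => // x; rewrite mul1r.
Qed.

(** The space [E] spanned by [Z], finitely many vectors and [x], [y] contains
    [Y], so it has the Daugavet property, and the quotient map by [Z] has
    finite rank on it. *)
Lemma wealthy_finite_codim_rich (Y Z : closedSubspace X) : wealthy Y ->
  Z `<=` Y -> finite_codim_in Y Z -> rich Z.
Proof.
move=> [_ wY] ZY [n [v [Yv Yspan]]] f x y /= x1 y1 e0 e00.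
(* With [e <= 1], the point found in the ball is not 0 and can be normalized. *)
pose e := Num.min e0 1.
have e_gt0 : 0 < e by rewrite lt_min e00 ltr01.
have e_le : e <= e0 by rewrite ge_min lexx.
have e_le1 : e <= 1 by rewrite ge_min lexx orbT.
have [E [b [ZE vsE bpsd bZ]]] :=
  finite_extension Z (x :: y :: [seq v i | i <- enum 'I_n]).
have Ex : (E : set X) x by apply: vsE; rewrite inE eqxx.
have Ey : (E : set X) y by apply: vsE; rewrite !inE eqxx orbT.
have Ev i : (E : set X) (v i).
  by apply: vsE; rewrite !inE map_f ?orbT// mem_enum.
have YE : Y `<=` E.
  move=> w Yw; have [c Zw] := Yspan w Yw.
  have : w \in subspace_pred E.
    rewrite -(subrK (\sum_(i < n) c i *: v i) w) rpredD//.
      exact/mem_set/ZE.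
    by apply: rpred_sum => i _; apply: rpredZ; exact/mem_set.
  by move=> /set_mem.
have sE := daugavet_slicesP (wY E YE).
pose xE := SubspaceType (mem_set Ex : x \in subspace_pred E).
pose yE := SubspaceType (mem_set Ey : y \in subspace_pred E).
have [T TE] := subspace_val_boundedOp E.
have [fT fTE] : exists g : boundedOp (subspace_type E) R^o,
    forall w, g w = f (subspace_val w).
  have [M M0 fM] := boundedOpP f.
  apply: (boundedOp_intro (M := M)) => [a u w|w]; last exact: fM.
  by rewrite -linearP.
have [M M0 fM] := boundedOpP f.
have e40 : 0 < e / 4 by rewrite divr_gt0.
have [d d0 dZ] := bZ _ e40.
pose r := e / (2 * (M + 2)).
have r0 : 0 < r by rewrite divr_gt0// mulr_gt0//; lra.
have rE : 2 * ((M + 2) * r) = e by rewrite /r; field; rewrite gt_eqF//; lra.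
have Mr : 0 <= M * r by rewrite mulr_ge0// ltW.
pose h := Num.min d ((e / 4) ^+ 2).
have h0 : 0 < h by rewrite lt_min d0 exprn_gt0.
have yE1 : `|yE| <= 1 by rewrite subspace_normE y1.
have [z [z1 bz xz]] := daugavet_hilbertian (bounded_psd_rank1D T fT bpsd) sE
  (x1 : `|xE| = 1) xE yE1 h0 r0.
move: bz; rewrite !TE !fTE => bz.
set w : X := subspace_val (z - yE) in bz.
have wE : w = subspace_val z - y by [].
have Ew : (E : set X) w by apply: set_mem; exact: subspace_valP.
have fw2 : 0 <= f w * f w by rewrite -expr2 sqr_ge0.
have bw := psd_ge0 bpsd w.
move: bz; rewrite lt_min => /andP[wd we].
have [|s Zs ws] := dZ _ Ew; first by lra.
have qw : `|quotient_map Z w| < e / 4.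
  exact: le_lt_trans (quotient_norm_dist_le w Zs) ws.
have fw : `|f w| < e / 4.
  rewrite -(ltr_pXn2r (n := 2))// ?nnegrE ?(ltW e40)//.
  by rewrite -normrX ger0_norm ?sqr_ge0// expr2; lra.
rewrite !subspace_normE /= x1 in z1 xz.
set z0 := subspace_val z in z1 xz wE.
have z0r : 1 - r < `|z0| by have := ler_normD x z0; rewrite x1; lra.
have r1 : r < 1 by lra.
have [u u1 uz] := unit_sphere_close r1 z0r z1.
exists u; split=> //.
  rewrite tilde_add_normE.
  have -> : u - y = (u - z0) + w by rewrite wE addrA subrK.
  rewrite (linearD (quotient_map Z)) (linearD f) /=.
  have := ler_normD (quotient_map Z (u - z0)) (quotient_map Z w).
  have := ler_normD (f (u - z0)) (f w).
  have := quotient_norm_le Z (u - z0); have := fM (u - z0).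
  have := ler_wpM2l M0 (ltW uz).
  move=> h1 h2 h3 h4 h5.
  have h3' : `|quotient_map Z (u - z0)| <= `|u - z0| by exact: h3.
  lra.
have : `|x + z0| <= `|u + x| + `|u - z0|.
  rewrite -[X in _ <= _ + X]normrN; apply: le_trans (ler_normD _ _).
  by rewrite opprB [u + x]addrC -addrA [u + _]addrC subrK.
lra.
Qed.

(** Richness is applied to the extension [g] of the functional [f] of the slice.
    It produces [z] almost in [u + Y], hence almost in [Z]; subtracting the
    small vector [w] puts it in [Z], and a slight contraction puts it back in
    the ball. *)
Lemma rich_daugavet (Y Z : closedSubspace X) : rich Y -> Y `<=` Z ->
  daugavet (subspace_type Z).
Proof.
move=> rY YZ; apply: slices_daugavet => f x u0 d e x1 u01 d0 e0.
(* Narrowness speaks of unit vectors, so [u0] is moved to the sphere. *)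
have [u u1 fu] : exists2 u : subspace_type Z, `|u| = 1 & f u0 <= f u.
  have [fu0|fu0] := leP (f u0) 0.
    have [fx|fx] := leP 0 (f x); first by exists x => //; exact: le_trans fx.
    exists (- x); first by rewrite normrN.
    by rewrite linearN (le_trans fu0)// oppr_ge0 ltW.
  have u0n : 0 < `|u0|.
    rewrite normr_gt0; apply/eqP => u00.
    by move: fu0; rewrite u00 linear0 ltxx.
  exists (`|u0|^-1 *: u0); first by rewrite normrZ normfV normr_id mulVf// gt_eqF.
  by rewrite linearZ ler_peMl ?(ltW fu0)// invr_ge1 ?unitfE ?gt_eqF.
have [g gf] := boundedOp_extend f.
have [M M0 gM] := boundedOpP g.
pose r := Num.min (d / (2 * (1 + 2 * M))) (e / 5).
have r0 : 0 < r by rewrite lt_min !divr_gt0// mulr_gt0//; lra.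
have rd : r * (2 * (1 + 2 * M)) <= d.
  by rewrite -ler_pdivlMr ?ge_min ?lexx//; rewrite mulr_gt0//; lra.
have re : r * 5 <= e by rewrite -ler_pdivlMr// ge_min lexx orbT.
have [z [z1]] := rY g (subspace_val x) (subspace_val u) x1 u1 r r0.
rewrite tilde_add_normE => zu zx.
have gzu := normr_ge0 (g (z - subspace_val u)).
have qzu := normr_ge0 (quotient_map Y (z - subspace_val u)).
have [w qw wr] := quotient_norm_lt (quotient_map Y (z - subspace_val u)) r0.
have w2r : `|w| < 2 * r.
  apply: lt_trans wr _.
  have : `|quotient_map Y (z - subspace_val u)| < r by lra.
  by rewrite [X in X < _ -> _]/(quotient_norm _); lra.
have Zw : (Z : set X) (z - w).
  have : (Y : set X) (z - subspace_val u - w).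
    by apply/quotient_map_eq; rewrite qw.
  move=> /YZ h; have := subspaceP 1 h (set_mem (subspace_valP u)).
  by rewrite scale1r addrAC subrK.
pose v := SubspaceType (mem_set Zw : (z - w) \in subspace_pred Z).
have v1 : `|v| <= 1 + 2 * r.
  rewrite subspace_normE /= (le_trans (ler_normB _ _))//.
  by have := z1 : `|z| = 1; lra.
have r21 : 0 < 1 + 2 * r by lra.
pose t := (1 + 2 * r)^-1.
have t0 : 0 < t by rewrite invr_gt0.
have tv : t * `|v| <= 1 by rewrite mulrC ler_pdivrMr// mul1r.
have t1 : t <= 1 by rewrite invf_le1//; lra.
have vtv : `|v - t *: v| <= 2 * r.
  rewrite -[X in X - _]scale1r -scalerBl normrZ ger0_norm ?subr_ge0//.
  apply: (le_trans (ler_wpM2l _ v1)); first by rewrite subr_ge0.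
  by rewrite mulrBl mulVf ?gt_eqF//; lra.
exists (t *: v); split.
- by rewrite normrZ gtr0_norm.
- have gv : f v = g (z - w) by rewrite -gf.
  have gu : f u = g (subspace_val u) by rewrite -gf.
  have ftv : f v - f (t *: v) <= M * (2 * r).
    have <- : g (subspace_val (v - t *: v)) = f v - f (t *: v).
      by rewrite gf linearB.
    rewrite (le_trans (ler_norm _))// (le_trans (gM _))//.
    by rewrite ler_wpM2l.
  have gw : g w <= M * (2 * r).
    rewrite (le_trans (ler_norm _))// (le_trans (gM _))// ler_wpM2l//.
    exact: ltW.
  have gzu' : - g (z - subspace_val u) < r.
    by have := ler_norm (- g (z - subspace_val u)); rewrite normrN; lra.
  rewrite linearB in gzu'; rewrite linearB in gv.
  lra.
have h1 : `|z + subspace_val x| <= `|subspace_val x + (z - w)| + `|w|.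
  apply: le_trans (ler_normD _ _).
  by rewrite addrA subrK addrC.
have h2 : `|x + v| <= `|x + t *: v| + `|v - t *: v|.
  apply: le_trans (ler_normD _ _).
  by rewrite -addrA [t *: v + _]addrC subrK.
have h3 : `|x + v| = `|subspace_val x + (z - w)| by [].
lra.
Qed.

End rich_subspaces.

Theorem theorem5p12 (R : realType) (X : completeNormedModType R)
    (Y : closedSubspace X) (hX : daugavet X) :
  (wealthy Y <-> rich Y) /\
  (rich Y <->
   forall Z : closedSubspace X, Z `<=` Y -> finite_codim_in Y Z -> rich Z).
Proof.
have codim0 : finite_codim_in Y Y.
  exists 0%N, (fun _ => 0); split=> [[]//|y Yy]; exists (fun _ => 0).
  by rewrite big_ord0 subr0.
have rich_wealthy : rich Y -> wealthy Y.
  move=> rY; split; first exact: rich_daugavet rY _.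
  by move=> Z YZ; exact: rich_daugavet rY YZ.
split; split.
- by move=> wY; exact: wealthy_finite_codim_rich codim0.
- exact: rich_wealthy.
- by move=> /rich_wealthy wY Z ZY; exact: wealthy_finite_codim_rich.
- by move=> /(_ Y); apply.
Qed.
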